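(* For every Gul'ko compactum $X$ we have $dis(X) \geq \Delta(X)$.
   Context: All spaces are Hausdorff. A Gul'ko compactum is a compact space $X$ such that $C_p(X)$ (the space of continuous real-valued functions on $X$ with the topology of pointwise convergence) is a Lindelöf $\Sigma$-space; a Lindelöf $\Sigma$-space is a continuous image of a space that admits a perfect map onto a separable metrizable space. $dis(X)$ denotes the least number of discrete sets required to cover $X$ (a subset of $X$ is discrete if its subspace topology is discrete; it need not be closed in $X$). $\Delta(X)$ denotes the least cardinality of a nonempty open subset of $X$ (for nonempty $X$). *)

(* Defs.v *)
From mathcomp Require Import all_boot all_order all_algebra.
From mathcomp Require Import all_classical all_reals all_analysis.

Set Implicit Arguments.
Unset Strict Implicit.
Unset Printing Implicit Defensive.

Import Order.TTheory GRing.Theory Num.Theory.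
Import numFieldTopology.Exports.

Local Open Scope classical_set_scope.
Local Open Scope ring_scope.
Local Open Scope card_scope.

Definition Cp (R : realType) (X : topologicalType) : topologicalType :=
  set_type [set f : {ptws X -> R} | continuous (f : X -> R)].

(* Surjectivity is not part of the definition; it is required separately. *)
Definition perfect_map (Y Z : topologicalType) (f : Y -> Z) : Prop :=
  [/\ continuous f,
      forall F : set Y, closed F -> closed (f @` F) &
      forall z : Z, compact (f @^-1` [set z])].

Definition separable (Z : topologicalType) : Prop :=
  exists2 D : set Z, countable D & dense D.

(* [Y] is required to be Hausdorff because all spaces are; [M] is Hausdorff
   since it is metric, and no such hypothesis on [T] is needed below, where
   [T] is [Cp R X]. *)
Definition lindelof_sigma (R : realType) (T : topologicalType) : Prop :=
  exists (Y : topologicalType) (M : metricType R) (p : Y -> M) (g : Y -> T),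
    [/\ hausdorff_space Y,
        separable M,
        perfect_map p /\ range p = [set: M] &
        continuous g /\ range g = [set: T]].

Definition gulko_compactum (R : realType) (X : topologicalType) : Prop :=
  [/\ hausdorff_space X, compact [set: X] & lindelof_sigma R (Cp R X)].

Definition discrete_subset (X : topologicalType) (A : set X) : Prop :=
  forall B : set (set_type A), open B.

(* MathComp has no type of cardinals, only comparisons [#<=] of sets. A least
   cardinal is thus represented by a set realizing it: [least_card P] is a
   member of [P] of least cardinality, by [least_cardP], and [set0] if [P] is
   empty. *)
Definition least_card (T : Type) (P : set (set T)) : set T :=
  xget set0 [set A | P A /\ forall B, P B -> A #<= B].

Definition discrete_cover (X : topologicalType) (C : set (set X)) : Prop :=
  (forall A, C A -> discrete_subset A) /\ \bigcup_(A in C) A = [set: X].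

Definition dis (X : topologicalType) : set (set X) :=
  least_card (@discrete_cover X).

Definition Delta (X : topologicalType) : set X :=
  least_card [set U : set X | open U /\ U !=set0].

Arguments dis : clear implicits.
Arguments Delta : clear implicits.

Lemma least_cardP (T : Type) (P : set (set T)) : P !=set0 ->
  P (least_card P) /\ forall B, P B -> least_card P #<= B.
Proof.
move=> [A0 PA0]; apply: (@xgetPex _ set0 [set A | P A /\ forall B, P B -> A #<= B]).
pose Q (S : set (set T -> T)) :=
  (forall f, S f -> forall A, P A -> A (f A)) /\
  (forall f g, S f -> S g -> forall A, P A -> f A = g A -> f = g).
have [F FQ Ftot|S [[Sin Sinj] Smax]] := @Zorn_bigcup _ Q.
  split=> [f [S FS Sf]|f g [S FS Sf] [S' FS' Sg]]; first exact: (FQ _ FS).1.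
  have [/(_ _ Sf) S'f|/(_ _ Sg) S'g] := Ftot _ _ FS FS'.
    exact: (FQ _ FS').2.
  exact: (FQ _ FS).2.
have Sle B : P B -> S #<= B.
  move=> PB; have SB : {in S &, injective (fun f : set T -> T => f B)}.
    by move=> f g /set_mem Sf /set_mem Sg; exact: Sinj.
  rewrite -(card_le_eql (inj_card_eq SB)).
  by apply: subset_card_le => _ [f Sf <-]; exact: Sin Sf _ PB.
have [[A PA AS]|noA] := pselect (exists2 A, P A & A `<=` (fun f => f A) @` S).
  exists A; split=> // B PB; apply: card_le_trans (Sle B PB).
  apply: card_le_trans (card_image_le (fun f : set T -> T => f A) S).
  exact: subset_card_le.
have pick A : P A -> exists x, A x /\ forall f, S f -> f A <> x.
  move=> PA; apply: contrapT => npick; apply: noA; exists A => // x Ax.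
  apply: contrapT => nx; apply: npick; exists x; split=> // f Sf fAx.
  by apply: nx; exists f.
have [x0 _] := pick _ PA0.
have [h hP] : exists h : set T -> T, forall A, P A ->
    A (h A) /\ forall f, S f -> f A <> h A.
  have /choice[h hP] : forall A, exists x, P A ->
      A x /\ forall f, S f -> f A <> x.
    move=> A; have [/pick[x Ax]|nPA] := pselect (P A); first by exists x.
    by exists x0 => /nPA.
  by exists h.
exfalso; apply: (Smax (S `|` [set h])).
  split=> [f Sf|SUh]; first by left.
  have /((hP _ PA0).2 h) : S h by apply: SUh; right.
  exact.
split=> [f [Sf|->] A PA|f g [Sf|->] [Sg|->] A PA //].
- exact: Sin Sf _ PA.
- exact: (hP _ PA).1.
- exact: Sinj Sf Sg _ PA.
- by move=> /((hP _ PA).2 _ Sf).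
- by move=> /esym/((hP _ PA).2 _ Sg).
Qed.

Lemma disP (X : topologicalType) : discrete_cover (dis X) /\
  forall C : set (set X), discrete_cover C -> dis X #<= C.
Proof.
apply: least_cardP; exists [set [set x] | x in [set: X]]; split=> [_ [x _ <-] B|].
  suff [->|->] : B = set0 \/ B = setT by [exact: open0|exact: openT].
  have all_eq (y z : set_type [set x]) : y = z.
    by apply: val_inj; rewrite (set_valP y) (set_valP z).
  have [[y By]|nB] := pselect (B !=set0); last by left; apply/seteqP; split=> // z Bz; apply: nB; exists z.
  by right; apply/seteqP; split=> // z _; rewrite (all_eq z y).
by apply/seteqP; split=> // x _; exists [set x] => //; exists x.
Qed.

Lemma DeltaP (X : topologicalType) : [set: X] !=set0 ->
  [/\ open (Delta X), Delta X !=set0 &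
      forall U : set X, open U -> U !=set0 -> Delta X #<= U].
Proof.
move=> X0; have [|[? ?] Dle] := @least_cardP _ [set U : set X | open U /\ U !=set0].
  by exists setT; split=> //; exact: openT.
by split=> // U oU U0; exact: Dle.
Qed.

(* Main.v *)
Require Import Defs.
From mathcomp Require Import all_boot all_order all_algebra.
From mathcomp Require Import all_classical all_reals all_analysis.

(* Let [X] be covered by an infinite family [C] of discrete sets. As [C_p(X)]
   is Lindelof Sigma, every subset [A] of [X] has a set [F(A)] of at most
   [|A| + omega] continuous functions, finitary in [A], such that the sets
   [P = {f_1 > 1/2} `&` ... `&` {f_k > 1/2}] with the [f_i] in [F(A)] induce a
   base of [closure A]. Starting from a point, let [A_(n+1)] add to [A_n], for
   each such [P] over [F(A_n)], a point of [P `&` D] for each [D] in [C] and a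
   point of [P `\` closure A_n], whenever these are nonempty. The union [A] of
   the [A_n] has at most [|C|] points. It is closed: if [x] is in [closure A]
   and in [D], choose [P] such that [P `&` closure A `&` D = {x}]; then the
   point of [A] chosen in [P `&` D] must be [x]. By Baire's theorem, some
   [closure A_n] contains a nonempty [P `&` A], and the points chosen outside
   [closure A_m] for large [m] show that [P] is contained in [A]. *)

Set Implicit Arguments.
Unset Strict Implicit.
Unset Printing Implicit Defensive.

Import Order.TTheory GRing.Theory Num.Theory.
Import numFieldTopology.Exports.

Local Open Scope classical_set_scope.
Local Open Scope ring_scope.
Local Open Scope card_scope.

(** * Cardinal arithmetic below an infinite cardinal *)

Lemma card_le_injP T (U : pointedType) (A : set T) (B : set U) :
  A #<= B <-> exists2 f : T -> U, set_fun A B f & {in A &, injective f}.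
Proof. by split=> [/pcard_leP/injfunPex//|fP]; apply/pcard_leP/injfunPex. Qed.

Lemma card_le_total T (A B : set T) : A #<= B \/ B #<= A.
Proof.
have [|PL leL] := @least_cardP T [set A; B]; first by exists A; left.
case: PL leL => -> leL; first by left; apply: leL; right.
by right; apply: leL; left.
Qed.

Section square.
Context {U : pointedType}.
Implicit Types (K S : set U) (G : set (U * U * U)).

(* Zorn's lemma is applied to graphs of injections [S * S -> S]; [field G]
   is the set [S]. *)
Let field G : set U :=
  [set u | exists2 t, G t & u \in [:: t.1.1; t.1.2; t.2]].

(** A triple [(u, v, w)] stands for [h (u, v) = w]. The equivalence says at once that [h] is
    single-valued and injective. Every clause survives unions of chains, as Zorn's lemma
    requires. *)
Let square_graph K G := [/\ field G `<=` K,
  forall t t', G t -> G t' -> (t.1 = t'.1 <-> t.2 = t'.2) &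
  forall u v, field G u -> field G v -> exists w, G (u, v, w)].

Let graph_of S (h : U * U -> U) : set (U * U * U) :=
  [set t | [/\ S t.1.1, S t.1.2 & t.2 = h t.1]].

Let field_graph_of S h : set_fun (S `*` S) S h -> field (graph_of S h) = S.
Proof.
move=> hS; apply/seteqP; split=> [u [[[a b] c] /= [/= Sa Sb /= ->]]|u Su].
  by rewrite !inE => /or3P[] /eqP -> //; exact: hS.
by exists (u, u, h (u, u)) => //; rewrite mem_head.
Qed.

Let square_graph_of K S h : S `<=` K -> set_fun (S `*` S) S h ->
  {in S `*` S &, injective h} -> square_graph K (graph_of S h).
Proof.
move=> SK hS hinj; split; rewrite ?field_graph_of//.
- move=> [p c] [p' c'] [/= Sa Sb /= ->] [/= Sa' Sb' /= ->].
  by split=> [->//|]; apply: hinj; rewrite inE; split.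
- by move=> u v Su Sv; exists (h (u, v)).
Qed.

Let graph_field K G : square_graph K G -> exists h,
  [/\ set_fun (field G `*` field G) (field G) h,
      {in field G `*` field G &, injective h} & G = graph_of (field G) h].
Proof.
move=> [_ Ginj Gtot].
have /choice[h hP] : forall p, exists w,
    field G p.1 -> field G p.2 -> G (p, w).
  move=> [u v]; have [[Gu Gv]|nG] := pselect (field G u /\ field G v).
    by have [w Gw] := Gtot _ _ Gu Gv; exists w.
  by exists u => Gu Gv; case: nG.
exists h; split.
- move=> p [Gu Gv]; exists (p, h p); first exact: hP.
  by rewrite !inE eqxx !orbT.
- move=> p q /set_mem[pu pv] /set_mem[qu qv] hpq.
  by apply: (proj2 (Ginj _ _ (hP _ pu pv) (hP _ qu qv))).
- apply/seteqP; split=> [[[u v] w] Gt|[[u v] w] [/= Gu Gv /= ->]];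
    last exact: hP.
  have Gu : field G u by exists (u, v, w); rewrite // mem_head.
  have Gv : field G v by exists (u, v, w); rewrite // !inE eqxx orbT.
  split=> //=; apply: (proj1 (Ginj _ _ Gt (hP (u, v) Gu Gv))); reflexivity.
Qed.

(** The map [code] embeds the union into [S], using the disjoint ranges of [h (s0, _)] and
    [h (s1, _)]. A pair outside [S * S] is coded into [S * S], sent to [S] by [h] and then to [S']
    by [j]; such values cannot collide with the old ones, which lie in [S]. *)
Lemma extend_square S S' h :
  S `&` S' = set0 -> S #<= S' -> S' #<= S ->
  (exists u v, [/\ S u, S v & u <> v]) ->
  set_fun (S `*` S) S h -> {in S `*` S &, injective h} ->
  exists h', [/\ set_fun ((S `|` S') `*` (S `|` S')) (S `|` S') h',
    {in (S `|` S') `*` (S `|` S') &, injective h'} &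
    forall p, (S `*` S) p -> h' p = h p].
Proof.
move=> SS' /card_le_injP[j jS jinj] /card_le_injP[i iS iinj].
move=> [s0 [s1 [Ss0 Ss1 s01]]] hS hinj.
have notS u : S' u -> ~ S u.
  by move=> S'u Su; have : (S `&` S') u by []; rewrite SS'.
pose code u := if u \in S then h (s0, u) else h (s1, i u).
have codeS u : (S `|` S') u -> S (code u).
  move=> SSu; rewrite /code.
  case: ifPn => [/set_mem Su|/negP nSu]; first exact: hS.
  by apply: hS; split=> //; apply: iS; case: SSu => // /mem_set.
have code_inj : {in S `|` S' &, injective code}.
  move=> u v /set_mem Su /set_mem Sv; rewrite /code.
  have inS' w : (S `|` S') w -> ~ w \in S -> S' w by move=> [/mem_set|].
  case: ifPn => [/set_mem uS|/negP nuS];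
    case: ifPn => [/set_mem vS|/negP nvS] e.
  - by have [] : (s0, u) = (s0, v) by apply: hinj; rewrite ?inE.
  - have [] // : (s0, u) = (s1, i v).
    by apply: hinj; rewrite ?inE //; split=> //; apply: iS; apply: inS'.
  - have [/esym] // : (s1, i u) = (s0, v).
    by apply: hinj; rewrite ?inE //; split=> //; apply: iS; apply: inS'.
  - have [] : (s1, i u) = (s1, i v).
      by apply: hinj; rewrite ?inE //; split=> //; apply: iS; apply: inS'.
    by apply: iinj; rewrite inE; apply: inS'.
pose h' p := if p \in S `*` S then h p else j (h (code p.1, code p.2)).
have jcS p : ((S `|` S') `*` (S `|` S')) p -> S (h (code p.1, code p.2)).
  by move=> [p1 p2]; apply: hS; split; apply: codeS.
exists h'; split.
- move=> p pS; rewrite /h'; case: ifPn => [/set_mem/hS|_]; first by left.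
  by right; apply/jS/jcS.
- move=> p q /set_mem pS /set_mem qS; rewrite /h'.
  case: ifPn => [pSS|_]; case: ifPn => [qSS|_] e.
  + exact: hinj e.
  + by have := hS _ (set_mem pSS); rewrite e => /(notS _ (jS _ (jcS _ qS))).
  + by have := hS _ (set_mem qSS); rewrite -e => /(notS _ (jS _ (jcS _ pS))).
  + have {}e := jinj _ _ (mem_set (jcS _ pS)) (mem_set (jcS _ qS)) e.
    have : (code p.1, code p.2) = (code q.1, code q.2).
      by apply: hinj e; rewrite inE; split; apply: codeS;
        (apply pS.1 || apply pS.2 || apply qS.1 || apply qS.2).
    case: pS qS => p1 p2 [q1 q2] [e1 e2].
    rewrite (surjective_pairing p) (surjective_pairing q).
    by congr pair; apply: code_inj; rewrite ?inE.
- by move=> p pS; rewrite /h' mem_set.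
Qed.

(** Take a maximal injection [h] of [S * S] into [S] with [S] inside [K]. If the rest of [K] embeds
    in [S], then [K] embeds in [S] and inherits the inequality. Otherwise the rest contains a copy
    of [S], onto which [h] extends. *)
Lemma card_square_le K : infinite_set K -> K `*` K #<= K.
Proof.
move=> /infiniteP/card_le_injP[c cK cinj].
have {}cinj : injective c by move=> m n; apply: cinj; rewrite inE.
pose N := range c.
have [h0 h0N h0inj] :
    exists2 h, set_fun (N `*` N) N h & {in N `*` N &, injective h}.
  apply/card_le_injP.
  have /card_le_injP[b _ binj] : [set: nat * nat] #<= [set: nat].
    by rewrite (card_le_eql card_nat2).
  apply/card_le_injP.
  have /choice[d dP] : forall u, exists n, N u -> c n = u.
    by move=> u; have [[n _ <-]|nN] := pselect (N u); [exists n|exists 0%N].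
  exists (fun p => c (b (d p.1, d p.2))) => [p _|[u v] [u' v']].
    by exists (b (d p.1, d p.2)).
  move=> /set_mem[/= Nu Nv] /set_mem[/= Nu' Nv'] /cinj/binj.
  rewrite !inE => /(_ I I)[du dv].
  by rewrite -(dP _ Nu) -(dP _ Nv) -(dP _ Nu') -(dP _ Nv') du dv.
have N_K : N `<=` K by move=> _ [n _ <-]; exact: cK.
(* The empty chain has empty union, so [P] has to admit the empty graph. The second clause makes
   every nonempty graph, hence a maximal one, contain that of [h0]; this keeps [S] infinite. *)
pose P G := square_graph K G /\ (G !=set0 -> graph_of N h0 `<=` G).
have PN : P (graph_of N h0).
  split=> [|_]; last exact: subset_refl.
  exact: square_graph_of N_K h0N h0inj.
have [F FP Ftot|G [[Gsq GN] Gmax]] := @Zorn_bigcup _ P.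
  split; last first.
    move=> [t [G FG Gt]] t' Nt'; exists G => //.
    by apply: (FP _ FG).2 => //; exists t.
  have both t t' G G' : F G -> F G' -> G t -> G' t' ->
      exists2 H, F H & H t /\ H t'.
    move=> FG FG' Gt Gt'; have [GG'|GG'] := Ftot _ _ FG FG'.
      by exists G' => //; split=> //; exact: GG'.
    by exists G => //; split=> //; exact: GG'.
  split.
  - move=> u [t [G FG Gt] ut]; have [[GK _ _] _] := FP _ FG.
    by apply: GK; exists t.
  - move=> t t' [G FG Gt] [G' FG' Gt'].
    have [H FH [Ht Ht']] := both _ _ _ _ FG FG' Gt Gt'.
    by have [[_ Hinj _] _] := FP _ FH; exact: Hinj.
  - move=> u v [t [G FG Gt] ut] [t' [G' FG' Gt'] vt'].
    have [H FH [Ht Ht']] := both _ _ _ _ FG FG' Gt Gt'.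
    have [[_ _ Htot] _] := FP _ FH.
    by have [||w Hw] := Htot u v; [exists t|exists t'|exists w; exists H].
have NG : graph_of N h0 `<=` G.
  have [G0|G0] := pselect (G !=set0); first exact: GN.
  exfalso; apply: (Gmax _ _ PN).
  split=> [t Gt|/(_ (c 0%N, c 0%N, h0 (c 0%N, c 0%N)))].
    by case: G0; exists t.
  move=> /(_ _)/wrap[]; last by move=> Gt; apply: G0; eexists; exact: Gt.
  by split=> //; exists 0%N.
have [h [hS hinj Gh]] := graph_field Gsq.
set S := field G in hS hinj Gh.
have SK : S `<=` K by case: Gsq.
have NS : N `<=` S.
  by rewrite -(field_graph_of h0N) => u [t Nt ut]; exists t => //; exact: NG.
have S2 : exists u v, [/\ S u, S v & u <> v].
  exists (c 0%N), (c 1%N).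
  by split; [apply: NS; exists 0%N|apply: NS; exists 1%N|move=> /cinj].
have S0 : S !=set0 by have [u [v [Su _ _]]] := S2; exists u.
have SSS : S `*` S #<= S by apply/card_le_injP; exists h.
have [KS_le|S_le] := card_le_total (K `\` S) S.
  have KS : K #<= S.
    have /card_le_injP[i iS iinj] := KS_le.
    (* [K] embeds in [S * S]: points of [S] go to the row of [s0], the others to the row of [s1]. *)
    apply: card_le_trans SSS; have [s0 [s1 [Ss0 Ss1 s01]]] := S2.
    apply/card_le_injP.
    exists (fun u => if u \in S then (s0, u) else (s1, i u)).
      move=> u Ku; case: ifPn => [/set_mem//|/negP nSu]; split=> //=.
      by apply: iS; split=> // /mem_set.
    move=> u v /set_mem Ku /set_mem Kv.
    case: ifPn => [_|/negP nuS]; case: ifPn => [_|/negP nvS] [] //.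
    - by move=> /esym.
    - by apply: iinj; rewrite inE; split=> // /mem_set.
  apply: card_le_trans (card_le_trans SSS (subset_card_le SK)).
  have /card_le_injP[i iS iinj] := KS.
  apply/card_le_injP; exists (fun p => (i p.1, i p.2)).
    by move=> p [p1 p2]; split; exact: iS.
  move=> [u v] [u' v'] /set_mem[/= Ku Kv] /set_mem[/= Ku' Kv'] [eu ev].
  by congr pair; apply: iinj; rewrite ?inE.
have /card_le_injP[j jS jinj] := S_le.
pose S' := j @` S.
have [|||h' [h'S h'inj h'h]] := @extend_square S S' h _ _ _ S2 hS hinj.
- by apply/seteqP; split=> // u [Su [s Ss sj]]; case: (jS _ Ss); rewrite sj.
- by apply/card_le_injP; exists j => // u Su; exists u.
- exact: card_image_le.
(* The extension is proper, since its field contains [j s], which is not in [S]. *)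
exfalso; apply: (Gmax (graph_of (S `|` S') h')).
  split; last first.
    have [s Ss] := S0 => /(_ (j s, j s, h' (j s, j s))) /= GS.
    suff : S (j s) by case: (jS _ Ss).
    exists (j s, j s, h' (j s, j s)); last by rewrite mem_head.
    by apply: GS; split=> //; right; exists s.
  rewrite {1}Gh => -[[u v] w] [/= Su Sv /= ->].
  by split; [left|left|rewrite h'h].
split=> [|_].
  apply: square_graph_of => // u [/SK//|[s Ss <-]]; exact: (jS _ Ss).1.
apply: (subset_trans NG); rewrite {1}Gh => -[[u v] w] [/= Su Sv /= ->].
by split; [left|left|rewrite h'h].
Qed.

End square.

Section small.
Context {U : pointedType} {K : set U} (Koo : infinite_set K).

Lemma card_setX_le T1 T2 (A : set T1) (B : set T2) :
  A #<= K -> B #<= K -> A `*` B #<= K.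
Proof.
move=> /card_le_injP[f fK finj] /card_le_injP[g gK ginj].
apply: card_le_trans (card_square_le Koo).
apply/card_le_injP; exists (fun p => (f p.1, g p.2)).
  by move=> p [p1 p2]; split; [exact: fK|exact: gK].
move=> [u v] [u' v'] /set_mem[/= Ku Kv] /set_mem[/= Ku' Kv'] [eu ev].
by congr pair; [apply: finj|apply: ginj]; rewrite ?inE.
Qed.

Lemma countable_card_le T (A : set T) : countable A -> A #<= K.
Proof. by move=> /card_le_trans; apply; exact/infiniteP. Qed.

Lemma card_bigcup_nat_le T (A : nat -> set T) :
  (forall n, A n #<= K) -> \bigcup_n A n #<= K.
Proof.
move=> AK; have /choice[f fP] : forall n, exists f : T -> U,
    set_fun (A n) K f /\ {in A n &, injective f}.
  by move=> n; have /card_le_injP[f ? ?] := AK n; exists f.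
have /choice[m mP] : forall x, exists n, (\bigcup_n A n) x -> A n x.
  move=> x; have [[n _ An]|nA] := pselect ((\bigcup_n A n) x).
    by exists n.
  by exists 0%N.
have natK : [set: nat] #<= K by apply: countable_card_le; exact: countableP.
apply: card_le_trans (card_setX_le natK (card_lexx K)).
apply/card_le_injP; exists (fun x => (m x, f (m x) x)).
  by move=> x Ax; split=> //=; apply: (fP _).1; exact: mP.
move=> x y /set_mem Ax /set_mem Ay [mxy]; rewrite mxy.
by apply: (fP _).2; rewrite inE; [rewrite -mxy|]; exact: mP.
Qed.

Lemma card_setU_le T (A B : set T) : A #<= K -> B #<= K -> A `|` B #<= K.
Proof.
move=> AK BK; pose F n := if n == 0%N then A else B.
apply: card_le_trans (@card_bigcup_nat_le _ F _).
  by apply: subset_card_le => x [Ax|Bx]; [exists 0%N|exists 1%N].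
by move=> n; rewrite /F; case: ifP.
Qed.

Lemma card_seq_le (T : eqType) (A : set T) :
  A #<= K -> [set s : seq T | forall x, x \in s -> A x] #<= K.
Proof.
move=> AK; pose L n := [set s : seq T | size s = n /\ forall x, x \in s -> A x].
apply: card_le_trans (@card_bigcup_nat_le _ L _).
  by apply: subset_card_le => s As; exists (size s).
elim=> [|n IHn].
  apply: countable_card_le; apply: sub_countable (countable1 [::]).
  by apply: subset_card_le => s [/size0nil].
apply: card_le_trans (card_setX_le AK IHn).
apply: card_le_trans (card_image_le (fun p => p.1 :: p.2) _).
apply: subset_card_le => -[|x s] [//= [sn] As]; exists (x, s) => //=.
split=> /=; first by apply: As; rewrite mem_head.
by split=> // y ys; apply: As; rewrite inE ys orbT.
Qed.

End small.

(** * Compactness, Baire category and countable bases *)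

(** Without a finite subcover, the complements in [K] of finite unions generate a proper filter. A
    cluster point of it lies in some [U i], which is disjoint from the filter set [B [:: i]]. *)
Lemma compact_seq_cover (T : topologicalType) (I : eqType) (K : set T)
    (D : set I) (U : I -> set T) :
  compact K -> (forall i, D i -> open (U i)) -> K `<=` \bigcup_(i in D) U i ->
  exists2 s : seq I, (forall i, i \in s -> D i) &
    K `<=` \bigcup_(i in [set` s]) U i.
Proof.
move=> Kco oU KU; apply: contrapT => nos.
pose B (s : seq I) := K `\` \bigcup_(i in [set` s]) U i.
pose F := filter_from [set s : seq I | forall i, i \in s -> D i] B.
have FF : ProperFilter F.
  apply: filter_from_proper; last first.
    move=> s sD; apply: contrapT => B0; apply: nos; exists s => // x Kx.
    by apply: contrapT => nUx; apply: B0; exists x.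
  apply: filter_from_filter; first by exists [::].
  move=> s t sD tD; exists (s ++ t) => [i|x [Kx nUx]].
    by rewrite mem_cat => /orP[/sD|/tD].
  by split; split=> // -[i /= si Ux]; apply: nUx; exists i;
    rewrite //= mem_cat si ?orbT.
have [|x [Kx clx]] := Kco F FF; first by exists [::] => // x [].
have [i Di Ux] := KU _ Kx.
have FB : F (B [:: i]) by exists [:: i] => // j; rewrite inE => /eqP ->.
have [|y [[_ nUy] Uy]] := clx _ (U i) FB.
  by apply: open_nbhs_nbhs; split=> //; exact: oU.
by apply: nUy; exists i; rewrite //= mem_head.
Qed.

(** If no [C n] contains a nonempty relatively open part of [A], regularity gives open sets [O n]
    meeting [A] with the closure of [O n.+1] inside [O n] minus [C n]. A cluster point of the sets
    [A] cut with [O n] lies in [A] but in no [C n]. *)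
Lemma compact_baire (T : topologicalType) (A : set T) (C : nat -> set T) :
  hausdorff_space T -> compact [set: T] -> closed A -> A !=set0 ->
  (forall n, closed (C n)) -> A `<=` \bigcup_n C n ->
  exists n O, [/\ open O, A `&` O !=set0 & A `&` O `<=` C n].
Proof.
move=> hT cT clA [a0 Aa0] clC AC; apply: contrapT => noO.
have /choice[nxt nxtP] : forall nO : nat * set T, exists O' : set T,
    open nO.2 -> A `&` nO.2 !=set0 ->
    [/\ open O', A `&` O' !=set0 & closure O' `<=` nO.2 `\` C nO.1].
  move=> [n O] /=.
  have [[oO AO]|nO] := pselect (open O /\ A `&` O !=set0); last first.
    by exists O => oO AO; case: nO.
  have [x [[Ax Ox] nCx]] : exists x, (A `&` O) x /\ ~ C n x.
    apply: contrapT => nox; apply: noO; exists n, O; split=> // x AOx.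
    by apply: contrapT => nCx; apply: nox; exists x.
  have OCx : nbhs x (O `\` C n).
    apply: open_nbhs_nbhs; split=> //.
    by apply: openI => //; exact: closed_openC.
  have [V Vx VO] := compact_regular hT cT filterT OCx.
  exists V°; split=> //; first exact: open_interior.
    by exists x.
  by apply: subset_trans VO; apply: closureS; exact: interior_subset.
pose O := fix O n := if n is m.+1 then nxt (m, O m) else setT.
have OP n : open (O n) /\ A `&` O n !=set0.
  elim: n => [|n [oO AO]]; first by split; [exact: openT|exists a0].
  by have [] := nxtP (n, O n) oO AO.
have clO n : closure (O n.+1) `<=` O n `\` C n.
  by have [oO AO] := OP n; have [] := nxtP (n, O n) oO AO.
have O_le m n : (m <= n)%N -> O n `<=` O m.
  elim: n => [|n IHn]; first by rewrite leqn0 => /eqP ->.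
  rewrite leq_eqVlt => /orP[/eqP -> //|]; rewrite ltnS => /IHn.
  by apply: subset_trans => x /subset_closure/clO[].
pose F := filter_from setT (fun n => A `&` O n).
have FF : ProperFilter F.
  apply: filter_from_proper; last by move=> n _; case: (OP n).
  apply: filter_from_filter; first by exists 0%N.
  move=> m n _ _; exists (maxn m n) => // x [Ax Ox].
  by split; split=> //; apply: O_le Ox; rewrite ?leq_maxl ?leq_maxr.
have [x [Ax clx]] : A `&` cluster F !=set0.
  have Aco : compact A by apply: (subclosed_compact clA cT).
  by apply: Aco; exists 0%N => // x [].
have [n _ Cx] := AC _ Ax.
have /clO[_ /(_ Cx)//] : closure (O n.+1) x.
move=> V Vx; have [|y [[_ Oy] Vy]] := clx (A `&` O n.+1) V _ Vx.
  by exists n.+1.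
by exists y.
Qed.

Lemma metric_countable_base (R : realType) (M : metricType R) : separable M ->
  exists2 W : set (set M), countable W &
    forall (m : M) O, open O -> O m -> exists B, [/\ W B, B m & B `<=` O].
Proof.
move=> [D cD dD].
exists ((fun q : M * nat => ball q.1 (q.2.+1%:R^-1 : R)) @` (D `*` [set: nat])).
  apply: sub_countable (card_image_le _ _) _.
  by apply: countableX => //; exact: countableP.
move=> m O oO Om.
have /nbhs_ballP[r /= r0 rO] : nbhs m O by apply: open_nbhs_nbhs.
(* Half of [r] suffices: a ball of this radius about a point [d] this close to [m] stays within
   distance [r] of [m]. *)
have [n nr] : exists n, (n.+1%:R^-1 : R) < r / 2.
  have r20 : 0 < r / 2 by rewrite divr_gt0.
  have [n _ /(_ n (leqnn n)) nr] := near_infty_natSinv_lt (PosNum r20).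
  by exists n.
have [d [/= md Dd]] : ball m (n.+1%:R^-1 : R) `&` D !=set0.
  have := dD (ball m (n.+1%:R^-1 : R))°; case.
  - by exists m; apply: nbhsx_ballx; rewrite invr_gt0.
  - exact: open_interior.
  - by move=> d [/interior_subset md Dd]; exists d.
exists (ball d (n.+1%:R^-1 : R)); split; first by exists (d, n).
  exact: ball_sym.
move=> y dy; apply: rO.
apply: (@le_ball _ _ _ _ r); last exact: ball_triangle md dy.
by rewrite (splitr r) lerD// ltW.
Qed.

(** * Small separating families of functions and closing off *)

Lemma open_fun_lt (R : realType) (T : topologicalType) (f : T -> R) (c : R) :
  continuous f -> open [set t | f t < c].
Proof. by move=> /continuousP/(_ _ (@open_lt _ c)). Qed.

Lemma open_fun_gt (R : realType) (T : topologicalType) (f : T -> R) (c : R) :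
  continuous f -> open [set t | c < f t].
Proof. by move=> /continuousP/(_ _ (@open_gt _ c)). Qed.

(* [Y], [M] and [p] witness that the space of the functions [e y] is
   Lindelof Sigma. *)
Section closing_off.
Context {R : realType} {X Y : topologicalType} {M : metricType R}.
Context (p : Y -> M) (e : Y -> X -> R) (y0 : Y) (W : set (set M)).
Hypothesis p_perfect : perfect_map p.
Hypothesis W_base :
  forall (m : M) O, open O -> O m -> exists B, [/\ W B, B m & B `<=` O].
Hypothesis e_cont_r : forall y, continuous (e y).
Hypothesis e_cont_l : forall x, continuous (e ^~ x).
Hypothesis e_sep :
  forall x x', x <> x' -> exists y, 1/2 < e y x /\ e y x' < 1/2.

(** Rational bounds keep the tests on [A] at most |A| + omega in number, yet tests still detect any
    disagreement of two functions at a point. *)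
Let test (t : X * rat * bool) (y : Y) : Prop :=
  if t.2 then e y t.1.1 < ratr t.1.2 else ratr t.1.2 < e y t.1.1.

Let cand (c : set M * seq (X * rat * bool)) : set Y :=
  [set y | c.1 (p y) /\ forall t, t \in c.2 -> ~ test t y].

Let tests_on (A : set X) : set (seq (X * rat * bool)) :=
  [set b | forall t, t \in b -> A t.1.1].

(** For each base set and finite list of tests on [A], one [y] over the base set that fails all
    these tests is chosen, or [y0] if there is none. Each choice involves only finitely many points
    of [A]. *)
Let funs (A : set X) : set Y := (xget y0 \o cand) @` (W `*` tests_on A).

Let open_test t : open (test t).
Proof.
case: t => [[a q] []]; rewrite /test /=.
- exact: (open_fun_lt (ratr q) (@e_cont_l a)).
- exact: (open_fun_gt (ratr q) (@e_cont_l a)).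
Qed.

Let test_neq (u v : Y) a : e u a <> e v a ->
  exists q b, test (a, q, b) u /\ ~ test (a, q, b) v.
Proof.
move=> /eqP; rewrite neq_lt => /orP[] /rat_in_itvoo[q];
  rewrite in_itv /= => /andP[uq qv].
- by exists q, true; split=> //; apply/negP; rewrite -leNgt ltW.
- by exists q, false; split=> //; apply/negP; rewrite -leNgt ltW.
Qed.

(** Let [z] separate the two points. A function agreeing with [z] on [A] agrees with it on the
    closure, so it separates them too. Hence the fibre of [p z] is covered by [V] and by the tests
    on [A] that [z] fails, and finitely many of these suffice. A member of [funs A] failing the same
    tests, over a small enough base set, must lie in [V]. *)
Let funs_separate A x x' : closure A x -> closure A x' -> x <> x' ->
  exists2 y, funs A y & 1/2 < e y x /\ e y x' < 1/2.
Proof.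
move=> Ax Ax' /e_sep[z [zx zx']].
pose V := [set y | 1/2 < e y x /\ e y x' < 1/2].
have oV : open V.
  apply: openI.
  - exact: (open_fun_gt (1/2) (@e_cont_l x)).
  - exact: (open_fun_lt (1/2) (@e_cont_l x')).
have agree y u :
    closure A u -> (forall a, A a -> e y a = e z a) -> e y u = e z u.
  move=> Au yz; apply: contrapT => nyz.
  have o : open [set v | e y v - e z v != 0].
    have /continuousP/(_ _ (@open_neq _ 0)) :
        continuous (fun v => e y v - e z v).
      by move=> v; apply: continuousB; exact: e_cont_r.
    by [].
  have [|a [Aa /= ]] := Au [set v | e y v - e z v != 0].
    by apply: open_nbhs_nbhs; split=> //=; rewrite subr_eq0; apply/eqP.
  by rewrite yz// subrr eqxx.
pose T := [set t : X * rat * bool | A t.1.1 /\ ~ test t z].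
(* The index [None] stands for [V], so that one finite list can mix [V] with tests; [pmap id] later
   extracts the tests. *)
pose U (o : option (X * rat * bool)) := if o is Some t then test t else V.
have [|o|y /= py|s sD sU] := @compact_seq_cover _ _ (p @^-1` [set p z])
    [set o | if o is Some t then T t else True] U.
- by case: p_perfect.
- by case: o => [t|] _; [exact: open_test|exact: oV].
- have [Vy|nVy] := pselect (V y); first by exists None.
  have [a [Aa neq]] : exists a, A a /\ e y a <> e z a.
    apply: contrapT => noa; apply: nVy; rewrite /V /=.
    by rewrite !(agree y)// => a Aa; apply: contrapT => ?; apply: noa; exists a.
  by have [q [b [ty tz]]] := test_neq neq; exists (Some (a, q, b)).
pose O := \bigcup_(i in [set` s]) U i.
have oO : open O.
  by apply: bigcup_open => -[t|] _; [exact: open_test|exact: oV].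
(* [N] consists of the points whose whole fibre lies in [O]; it is open because [p] is a closed
   map. *)
pose N := ~` (p @` (~` O)).
have oN : open N.
  by apply: closed_openC; case: p_perfect => _ + _; apply; apply: open_closedC.
have [|B [WB Bz BN]] := W_base (m := p z) oN.
  by move=> [y nOy py]; apply: nOy; exact: sU.
pose b := pmap id s.
have bP t : (t \in b) = (Some t \in s) by rewrite /b mem_pmap map_id.
have candz : cand (B, b) z.
  by split=> //= t; rewrite bP => /sD[].
exists (xget y0 (cand (B, b))).
  by exists (B, b) => //; split=> //= t; rewrite bP => /sD[].
have [By nt] : cand (B, b) (xget y0 (cand (B, b))).
  by apply: (xgetPex y0); exists z.
set y := xget _ _ in By nt *.
have [[t|] /= os Uy] : O y; last exact: Uy.
  by apply: contrapT => nOy; apply: (BN _ By); exists y.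
by case: (nt t) => //=; rewrite bP.
Qed.

Let pos (l : seq Y) : set X := [set x | forall y, y \in l -> 1/2 < e y x].

Let open_pos l : open (pos l).
Proof.
elim: l => [|y l IHl].
  by have -> : pos [::] = setT; [apply/seteqP; split|exact: openT].
have -> : pos (y :: l) = [set x | 1/2 < e y x] `&` pos l; last first.
  by apply: openI => //; exact: (open_fun_gt (1/2) (@e_cont_r y)).
apply/seteqP; split=> [x xl|x [xy xl] z]; last first.
  by rewrite inE => /orP[/eqP -> //|]; exact: xl.
by split; [|move=> z zl]; apply: xl; rewrite inE ?eqxx// zl orbT.
Qed.

Hypothesis X_hausdorff : hausdorff_space X.
Hypothesis X_compact : compact [set: X].

(** Each point of the compact set [closure A] minus [O] is separated from [x] by a member of
    [funs A]. Finitely many of these functions are below 1/2 somewhere at every point of that set,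
    so their common positive set avoids it. *)
Let funs_base A x O : closure A x -> open O -> O x ->
  exists l, [/\ forall y, y \in l -> funs A y, pos l x &
    pos l `&` closure A `<=` O].
Proof.
move=> Ax oO Ox.
have KC : compact (closure A `\` O).
  apply: (subclosed_compact _ X_compact) => //.
  by apply: closedI; [exact: closed_closure|exact: open_closedC].
have [y [fy yx]|x' [Ax' nOx']|l lP lC] := @compact_seq_cover _ _ _
    [set y | funs A y /\ 1/2 < e y x] (fun y => [set x' | e y x' < 1/2]) KC.
- exact: (open_fun_lt (1/2) (@e_cont_r y)).
- have [y fy [yx yx']] : exists2 y, funs A y & 1/2 < e y x /\ e y x' < 1/2.
    by apply: funs_separate => // xx'; rewrite xx' in Ox.
  by exists y.
exists l; split=> [y /lP[]//|y /lP[]//|x' [lx' Ax']].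
apply: contrapT => nOx'; have [y /= yl yx'] := lC _ (conj Ax' nOx').
by have := lt_trans yx' (lx' _ yl); rewrite ltxx.
Qed.

Lemma exists_small_open (V : pointedType) (K : set V) (C : set (set X))
    (x0 : X) :
  infinite_set K -> countable W -> C #<= K ->
  (forall x, exists D O, [/\ C D, open O & D `&` O = [set x]]) ->
  exists O : set X, [/\ open O, O !=set0 & O #<= K].
Proof.
move=> Koo cW CK discC.
(* The default [x0] already belongs to every [An n], so picking from an empty set does no harm. *)
pose pick (q : seq Y * set X) := xget x0 (pos q.1 `&` q.2).
(* Treating the complement of the closure as one more member of [C] lets a single operation make
   both kinds of choices. *)
pose step A := A `|` pick @`
  ([set l | forall y, y \in l -> funs A y] `*` (C `|` [set ~` closure A])).
pose An := fix An n := if n is m.+1 then step (An m) else [set x0].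
pose A := \bigcup_n An n.
have funsK B : B #<= K -> funs B #<= K.
  move=> BK; apply: card_le_trans (card_image_le _ _) _.
  apply: (card_setX_le Koo); first exact: countable_card_le.
  have -> : tests_on B =
      [set s | forall t, t \in s -> ((B `*` setT) `*` setT) t].
    apply/seteqP; split=> [s sB t /sB //|s sB t /sB[[]]//].
  by apply: (card_seq_le Koo); do 2?apply: (card_setX_le Koo) => //;
    apply: countable_card_le => //; exact: countableP.
have AnK n : An n #<= K.
  elim: n => [|n IHn] /=.
    by apply: countable_card_le => //; exact: countable1.
  apply: (card_setU_le Koo) => //; apply: card_le_trans (card_image_le _ _) _.
  apply: (card_setX_le Koo); first exact/(card_seq_le Koo)/funsK.
  apply: (card_setU_le Koo) => //.
  by apply: countable_card_le => //; exact: countable1.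
have AK : A #<= K by exact: card_bigcup_nat_le.
have An_le m n : (m <= n)%N -> An m `<=` An n.
  elim: n => [|n IHn]; first by rewrite leqn0 => /eqP ->.
  by rewrite leq_eqVlt => /orP[/eqP -> //|/IHn AA x /AA]; left.
have AnA n : An n `<=` A by move=> x Ax; exists n.
(* A finite list from [funs A] involves finitely many points of [A], and these all occur by some
   stage. *)
have funs_bigcup (l : seq Y) : (forall y, y \in l -> funs A y) ->
    exists n, forall y, y \in l -> funs (An n) y.
  have funs_le m n : (m <= n)%N -> funs (An m) `<=` funs (An n).
    move=> mn; apply: image_subset => -[B b] [WB bm]; split=> // t /bm.
    exact: An_le.
  have testsA b : tests_on A b -> exists n, tests_on (An n) b.
    elim: b => [|t b IHb] tbA; first by exists 0%N.
    have [|n nb] := IHb; first by move=> s sb; apply: tbA; rewrite inE sb orbT.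
    have [|m _ mt] := tbA t; first exact: mem_head.
    exists (maxn m n) => s; rewrite inE => /orP[/eqP ->|/nb].
      by apply: An_le mt; rewrite leq_maxl.
    by apply: An_le; rewrite leq_maxr.
  elim: l => [|y l IHl] lA; first by exists 0%N.
  have [|n nl] := IHl; first by move=> z zl; apply: lA; rewrite inE zl orbT.
  have [|[B b] [WB /testsA[m mb]] <-] := lA y; first exact: mem_head.
  exists (maxn m n) => z; rewrite inE => /orP[/eqP ->|/nl].
    by apply: (funs_le m); rewrite ?leq_maxl//; exists (B, b).
  by apply: funs_le; rewrite leq_maxr.
have clA : closed A.
  move=> x Ax; have [D [G [CD oG DG]]] := discC x.
  have [Dx Gx] : (D `&` G) x by rewrite DG.
  have [l [lA lx lG]] := funs_base Ax oG Gx.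
  have [n ln] := funs_bigcup _ lA.
  have [lp Dp] : (pos l `&` D) (pick (l, D)) by apply: (xgetPex x0); exists x.
  have Ap : A (pick (l, D)).
    by exists n.+1 => //; right; exists (l, D) => //; split=> //; left.
  have <- // : pick (l, D) = x.
  suff : (D `&` G) (pick (l, D)) by rewrite DG.
  by split=> //; apply: lG; split=> //; exact: subset_closure.
have [|n|x [n _ Ax]|n [G [oG [x [Ax Gx]] AG]]] :=
    @compact_baire X A (fun n => closure (An n)) X_hausdorff X_compact clA.
- by exists x0, 0%N.
- exact: closed_closure.
- by exists n => //; exact: subset_closure.
have [l [lA lx lG]] := funs_base (subset_closure Ax) oG Gx.
have posA : pos l `&` A `<=` closure (An n).
  move=> y [ly Ay]; apply: AG; split=> //; apply: lG.
  by split=> //; exact: subset_closure.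
have [m lm] := funs_bigcup _ lA.
exists (pos l); split=> //; first by exists x.
apply: card_le_trans AK; apply: subset_card_le => y ly.
rewrite (closure_id A).1//.
apply: (closureS (AnA (maxn m n))); apply: contrapT => ny.
(* At stage [k] all functions of [l] are available, by [k >= m], and the closure contains that of
   [An n], by [k >= n]. The point picked at the next stage thus contradicts [posA]. *)
set k := maxn m n in ny *.
have [lp np] : (pos l `&` ~` closure (An k)) (pick (l, ~` closure (An k))).
  by apply: (xgetPex x0); exists y.
apply: np; apply: (closureS (An_le n k _)); first exact: leq_maxr.
apply: posA; split=> //; exists k.+1 => //; right.
exists (l, ~` closure (An k)) => //.
split; last by right.
move=> z /lm; apply: image_subset => -[B b] [WB bm]; split=> // t /bm.
by apply: An_le; exact: leq_maxl.
Qed.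

End closing_off.

(** * Discrete covers and the cardinal inequality *)

Lemma discrete_subset_isolated (X : topologicalType) (D : set X) (x : X) :
  discrete_subset D -> D x -> exists2 O, open O & D `&` O = [set x].
Proof.
move=> discD Dx; have [G oG GE] := discD [set z | set_val z = x].
exists G => //; apply/seteqP; split=> [y [Dy Gy]|_ ->].
  have : (set_val @^-1` G) (exist _ y (mem_set Dy) : D) by [].
  by rewrite GE.
split=> //.
suff : (set_val @^-1` G) (exist _ x (mem_set Dx) : D) by [].
by rewrite GE.
Qed.

Lemma finite_cover_isolated (X : topologicalType) (C : set (set X))
    (O : set X) :
  accessible_space X -> finite_set C -> (forall D, C D -> discrete_subset D) ->
  open O -> O !=set0 -> O `<=` \bigcup_(D in C) D -> exists x : X, open [set x].
Proof.
move=> T1 /finite_seqP[s ->]; elim: s O => [|D s IHs] O discs oO [x Ox] Os.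
  by have [] := Os _ Ox.
have discs' E : E \in s -> discrete_subset E.
  by move=> Es; apply: discs; rewrite /= inE Es orbT.
have IH G : open G -> G !=set0 -> G `<=` O -> D `&` G = set0 ->
    exists x : X, open [set x].
  move=> oG G0 GO DG; apply: (IHs G) => // y Gy.
  have [E] := Os _ (GO _ Gy).
  rewrite /= inE => /orP[/eqP -> Dy|Es Ey]; last by exists E.
  by have : (D `&` G) y by []; rewrite DG.
have [DO|[z [Dz Oz]]] : D `&` O = set0 \/ D `&` O !=set0.
  by have [/eqP|/set0P] := boolP (D `&` O == set0); [left|right].
  by apply: (IH O) => //; exists x.
have [|G oG DG] := @discrete_subset_isolated X D z _ Dz.
  by apply: discs; rewrite /= mem_head.
have [_ Gz] : (D `&` G) z by rewrite DG.
pose H := (O `&` G) `\` [set z].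
have [H0|[y Hy]] : H = set0 \/ H !=set0.
  by have [/eqP|/set0P] := boolP (H == set0); [left|right].
  exists z; rewrite (_ : [set z] = O `&` G); first exact: openI.
  apply/seteqP; split=> [_ ->//|y OGy]; apply: contrapT => yz.
  by have : H y by []; rewrite H0.
apply: (IH H); [| by exists y| by move=> ? [[]] |].
  apply: openI; first exact: openI.
  by apply: closed_openC; exact: accessible_closed_set1.
apply/seteqP; split=> // w [Dw [[_ Gw] wz]]; apply: wz.
by have : (D `&` G) w by []; rewrite DG.
Qed.

Lemma gulko_exists_small_open (R : realType) (X : topologicalType)
    (C : set (set X)) :
  gulko_compactum R X -> [set: X] !=set0 -> discrete_cover C ->
  exists O : set X, [/\ open O, O !=set0 & O #<= C].
Proof.
move=> [hX cX [Y [M [p [g [_ sM [p_perfect _] [g_cont g_surj]]]]]]].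
move=> [x0 _] [Cdisc CX].
have XC x : exists2 D, C D & D x.
  by have : [set: X] x by []; rewrite -CX => -[D CD Dx]; exists D.
(* The closing-off argument needs an infinite bound. For finite [C] there is an isolated point,
   whose singleton embeds in the nonempty [C]. *)
have [Cfin|Cinf] := pselect (finite_set C).
  have [||||x ox] := @finite_cover_isolated X C setT _ Cfin Cdisc.
  - exact: hausdorff_accessible.
  - exact: openT.
  - by exists x0.
  - by rewrite CX.
  exists [set x]; split=> //; first by exists x.
  have [D CD _] := XC x; apply/card_le_injP; exists (fun=> D) => //.
  by move=> y z /set_mem -> /set_mem ->.
have [W cW W_base] := metric_countable_base sM.
(* [e y] is the function named by [y]. Since [g] is surjective, every continuous function has a
   name, in particular the Urysohn functions that give [e_sep]. *)
pose e y x : R := (set_val (g y) : {ptws X -> R}) x.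
have e_surj f : continuous f -> exists y, e y = f.
  move=> cf; pose F : Cp R X := exist _ (f : {ptws X -> R}) (mem_set cf).
  have : [set: Cp R X] F by []; rewrite -g_surj => -[y _ gyF].
  by exists y; rewrite /e gyF.
have [y0 _] := e_surj _ (@cst_continuous X R 0).
apply: (@exists_small_open R X Y M p e y0 W _ _ _ _ _ _ _ _ _ C x0) => //.
- by move=> y; have := set_valP (g y).
- move=> x y.
  apply: (@continuous_comp _ _ _ g
    (fun h : Cp R X => (set_val h : {ptws X -> R}) x)).
    exact: g_cont.
  apply: (@continuous_comp _ _ _ (set_val : Cp R X -> {ptws X -> R})
    (fun h => h x)).
    exact: initial_continuous.
  exact: (@proj_continuous X (fun=> R) x).
- move=> x x' xx'.
  have cl1 : forall z, closed [set z] :=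
    accessible_closed_set1 (hausdorff_accessible hX).
  have /(@uniform_separatorP _ R)[f [cf _ f0 f1]] :
      uniform_separator [set x'] [set x].
    apply: normal_uniform_separator => //; first exact: compact_normal.
    by apply/seteqP; split=> // z [/= -> /esym].
  have [y ey] := e_surj f cf; exists y; rewrite ey.
  have -> : f x = 1 by apply: f1; exists x.
  have -> : f x' = 0 by apply: f0; exists x'.
  by split; [rewrite ltr_pdivrMr// mul1r ltr1n|rewrite divr_gt0].
- move=> x; have [D CD Dx] := XC x.
  by have [G oG DG] := discrete_subset_isolated (Cdisc _ CD) Dx; exists D, G.
Qed.

Theorem corollary2p16 (R : realType) (X : topologicalType)
    (hX : gulko_compactum R X) :
  Delta X #<= dis X.
Proof.
(* [DeltaP] requires a point; in the empty space [Delta X] is empty and the inequality is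
   trivial. *)
have [X0|X0] := pselect ([set: X] !=set0); last first.
  rewrite (_ : Delta X = set0); first exact: card_ge0.
  by apply/seteqP; split=> // x _; apply: X0; exists x.
have [G [oG G0 GC]] := gulko_exists_small_open hX X0 (disP X).1.
by have [_ _ DeltaG] := DeltaP X0; exact: card_le_trans (DeltaG _ oG G0) GC.
Qed.
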